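(* The decay rate in the trace estimate $$\mathrm{tr}(R^{(k)})\le\left(1-\frac{1}{N_n}\right)^k\mathrm{tr}(R)\qquad(k\ge 0),$$ which holds for every $R\in\mathcal{S}_1\cap B(H)_+$, every depth $n\ge 1$ and every depth $n$ (trace) greedy extraction sequence $(R^{(k)})_{k\ge0}$ starting from $R$, is optimal in general. More precisely, for every depth $n\ge 1$ there exists $R\in\mathcal{S}_1\cap B(H)_+$ such that the associated depth $n$ greedy extraction sequence satisfies $$R^{(k)}=\left(1-\frac{1}{N_n}\right)^kR$$ for all $k\ge 0$. Consequently, $$\mathrm{tr}(R^{(k)})=\left(1-\frac{1}{N_n}\right)^k\mathrm{tr}(R)$$ for all $k\ge 0$, so no better universal decay factor can replace $1-\frac{1}{N_n}$ in the trace estimate above.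
   Context: $H$ is a Hilbert space and $B(H)_+$ is the set of bounded positive operators on $H$; $\mathcal{S}_1$ is the trace class. $\mathcal{T}$ is a rooted finitely branching tree; $|w|$ denotes the depth of a node $w$ and $\mathrm{ch}(w)$ the finite set of children of $w$. $\{W_w\}_{w\in\mathcal{T}}$ is a family of closed subspaces of $H$ with orthogonal projections $P_w$ such that: for each $n\ge 0$, $H=\bigoplus_{|w|=n}W_w$ (orthogonal sum), so $I=\sum_{|w|=n}P_w$; and for each node $w$, $W_w=\bigoplus_{v\in\mathrm{ch}(w)}W_v$, i.e. $P_w=\sum_{v\in\mathrm{ch}(w)}P_v$, with $P_vP_{v'}=0$ for distinct $v,v'\in\mathrm{ch}(w)$. For $A\in B(H)_+$ and $w\in\mathcal{T}$, the packet content operator is $C_w(A)=A^{1/2}P_wA^{1/2}$. $\mathcal{T}_n=\{w\in\mathcal{T}:|w|=n\}$ and $N_n=\#\mathcal{T}_n$. For $R\in\mathcal{S}_1\cap B(H)_+$ and $n\ge 1$, the depth $n$ (trace) greedy extraction sequence starting from $R$ is defined by $R^{(0)}=R$ and, for each $k\ge 1$: choose $w_k\in\mathcal{T}_n$ with $\mathrm{tr}(C_{w_k}(R^{(k-1)}))=\max_{w\in\mathcal{T}_n}\mathrm{tr}(C_w(R^{(k-1)}))$, and set $D_k=C_{w_k}(R^{(k-1)})$ and $R^{(k)}=R^{(k-1)}-D_k$.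
   Formalization: The claim that no better universal decay factor is possible, and that R can be taken nonzero, is stated when N_n > 0 and all depth-n subspaces W_w are nonzero; it fails if some W_w = {0}. A greedy sequence is asserted to exist when N_n > 0. *)

(* Defs.v *)
From HB Require Import structures.
From mathcomp Require Import all_boot all_order all_algebra finmap.
From mathcomp Require Import complex.
From mathcomp Require Import all_classical all_reals all_analysis.

Set Implicit Arguments.
Unset Strict Implicit.
Unset Printing Implicit Defensive.

Import Order.TTheory GRing.Theory Num.Theory.
Import numFieldNormedType.Exports.

Local Open Scope classical_set_scope.
Local Open Scope complex_scope.
Local Open Scope ring_scope.

(* Complex Hilbert spaces, possibly non-separable or finite-dimensional; the
   inner product is linear in its first argument. *)
Record hilbert (R : realType) := Hilbert {
  hilbert_sort :> completeNormedModType R[i];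
  dot : {dot hilbert_sort for Num.conj};
  normr_dot : forall x : hilbert_sort, `|x| ^+ 2 = dot x x }.

Section Operators.
Context {R : realType} {H : hilbert R}.
Implicit Types (A B S : H -> H) (V : set H) (E : set H).

Definition bounded_op A :=
  linear A /\ exists M : R, forall x, `|A x| <= M%:C * `|x|.

(* On R[i], [0 <= z] means that z is real and nonnegative, so that positive
   operators are self-adjoint. *)
Definition positive_op A :=
  bounded_op A /\ forall x, 0 <= dot H (A x) x.

(* The positive square root of a positive operator; it exists and is unique.
   The default value 0 is only used when A is not positive. *)
Definition sqrt_op A : H -> H :=
  xget 0 [set S | positive_op S /\ S \o S = A].

Definition adjoint A : H -> H :=
  xget 0 [set B | bounded_op B /\ forall x y, dot H (A x) y = dot H x (B y)].

Definition abs_op A : H -> H := sqrt_op (adjoint A \o A).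

Definition orthonormal_basis E :=
  [/\ forall e, E e -> dot H e e = 1,
      forall e f, E e -> E f -> e <> f -> dot H e f = 0 &
      forall x, (forall e, E e -> dot H x e = 0) -> x = 0].

(* Orthonormal bases always exist, by Zorn's lemma. *)
Definition some_onb : set H := xget set0 [set E | orthonormal_basis E].

(* The trace of a positive operator, in [0, +oo]; its value does not depend on
   the orthonormal basis. *)
Definition trace A : \bar R :=
  \esum_(e in some_onb) (complex.Re (dot H (A e) e))%:E.

Definition trace_class A := bounded_op A /\ (trace (abs_op A) < +oo)%E.

Definition closed_subspace V :=
  [/\ V 0, forall (a : R[i]) x y, V x -> V y -> V (a *: x + y) & closed V].

Definition orthogonal_projection V (P : H -> H) :=
  forall x, V (P x) /\ forall y, V y -> dot H (x - P x) y = 0.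

Definition orthogonal_sum (I : choiceType) (s : {fset I}) (W : I -> set H) V :=
  (forall i j, i \in s -> j \in s -> i <> j ->
     forall x y, W i x -> W j y -> dot H x y = 0) /\
  V = [set x | exists2 u : I -> H,
         (forall i, i \in s -> W i (u i)) & x = \sum_(i <- s) u i].

End Operators.

Fixpoint level_of (N : choiceType) (root : N) (ch : N -> {fset N}) (n : nat)
    : {fset N} :=
  if n is m.+1 then (\bigcup_(w <- level_of root ch m) ch w)%fset
  else [fset root]%fset.

Record rooted_tree := RootedTree {
  node :> choiceType;
  tree_root : node;
  children : node -> {fset node};
  root_not_child : forall w, tree_root \notin children w;
  unique_parent : forall v w w',
    v \in children w -> v \in children w' -> w = w';
  root_connected : forall v, exists n, v \in level_of tree_root children n }.

Definition level (T : rooted_tree) (n : nat) : {fset T} :=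
  level_of (tree_root T) (@children T) n.

Record packet_tree (R : realType) (H : hilbert R) (T : rooted_tree) :=
  PacketTree {
    packet : T -> set H;
    packet_proj : T -> H -> H;
    packet_closed : forall w, closed_subspace (packet w);
    packet_projP : forall w,
      orthogonal_projection (packet w) (packet_proj w);
    packet_level : forall n, orthogonal_sum (level T n) packet setT;
    packet_children : forall w,
      orthogonal_sum (children w) packet (packet w) }.

Section Greedy.
Context {R : realType} {H : hilbert R} {T : rooted_tree} (W : packet_tree H T).

Definition content (w : T) (A : H -> H) : H -> H :=
  sqrt_op A \o packet_proj W w \o sqrt_op A.

(* [r k] is the remainder after k steps; the node w below is the one chosen at
   step k + 1, and ties may be broken arbitrarily. *)
Definition greedy_sequence (n : nat) (A : H -> H) (r : nat -> H -> H) :=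
  r 0%N = A /\
  forall k, exists w : T,
    [/\ w \in level T n,
        forall v, v \in level T n ->
          (trace (content v (r k)) <= trace (content w (r k)))%E &
        r k.+1 = r k - content w (r k)].

Definition nonzero_packets (n : nat) :=
  (0 < #|` level T n|)%N /\
  forall w, w \in level T n -> packet W w <> [set 0].

End Greedy.

(* 1 - 1 / N_n; when N_n = 0 there is no greedy sequence at depth n. *)
Definition decay_rate (K : fieldType) (T : rooted_tree) (n : nat) : K :=
  1 - (#|` level T n|)%:R^-1.

(* Main.v *)
Require Import Defs.
From mathcomp Require Import all_boot all_order all_algebra finmap.
From mathcomp Require Import complex.
From mathcomp Require Import all_classical all_reals all_analysis.
From mathcomp Require Import ring lra.

(** The trace estimate is an averaging argument. For a positive operator A with
    positive square root S, the packet contents S P_w S at depth n are positive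
    and add up to S S = A, because the projections at depth n add up to the
    identity ([content_sum]). The largest of their N traces is therefore at
    least tr A / N, and removing it leaves at most (1 - 1/N) tr A
    ([greedy_step_trace]). The remainder S (1 - P_w) S is again positive, so the
    estimate iterates ([greedy_trace_bound]).

    This needs every positive operator to have a positive square root
    ([sqrt_op_exists]). After rescaling, A = 1 - B with B a symmetric
    contraction, and the root is 1 - Y where Y = (B + Y^2) / 2. The iteration
    Y_{n+1} = (B + Y_n^2) / 2 from Y_0 = 0 is dominated in norm, increments
    included, by the same iteration on real numbers with B replaced by 1. That
    one is increasing and bounded by 1, so Y_n converges pointwise.

    For optimality, suppose the packets of depth n nontrivial, let e_w be a unit
    vector of each and x = N^(-1/2) * sum_w e_w, a unit vector whose energy
    <P_w x, x> is 1/N in every packet. Let A be the orthogonal projection <., x> x onto its line. The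
    only positive square root of c A is sqrt(c) A ([rank_one_sqrt_unique]), so
    every packet content of c A is (c <P_w x, x>) A = (c/N) A
    ([rank_one_content]): whichever packet is chosen, a greedy step multiplies
    the remainder by 1 - 1/N. The trace of A is finite by Bessel's inequality
    ([rank_one_trace_lty]). It is positive because an orthonormal basis exists
    ([rank_one_trace_gt0]), so the first step already rules out any smaller
    universal factor. *)

Set Implicit Arguments.
Unset Strict Implicit.
Unset Printing Implicit Defensive.

Import Order.TTheory GRing.Theory Num.Theory.
Import numFieldNormedType.Exports.

Local Open Scope classical_set_scope.
Local Open Scope complex_scope.
Local Open Scope ring_scope.

(** * Inner products *)

Section InnerProduct.
Context {R : realType} {H : hilbert R}.
Implicit Types x y z : H.

Lemma dotDl x y z : dot H (x + y) z = dot H x z + dot H y z.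
Proof. exact: linearDl. Qed.
Lemma dotBl x y z : dot H (x - y) z = dot H x z - dot H y z.
Proof. exact: linearBl. Qed.
Lemma dotDr x y z : dot H x (y + z) = dot H x y + dot H x z.
Proof. exact: linearDr. Qed.
Lemma dotBr x y z : dot H x (y - z) = dot H x y - dot H x z.
Proof. exact: linearBr. Qed.
Lemma dotZl (a : R[i]) x y : dot H (a *: x) y = a * dot H x y.
Proof. exact: linearZl_LR. Qed.
Lemma dotZr (a : R[i]) x y : dot H x (a *: y) = a^* * dot H x y.
Proof. exact: linearZr_LR. Qed.
Lemma dot0l x : dot H 0 x = 0.
Proof. exact: linear0l. Qed.
Lemma dot0r x : dot H x 0 = 0.
Proof. exact: linear0r. Qed.
Lemma dotC x y : dot H y x = (dot H x y)^*.
Proof. by rewrite hermC /= expr0 mul1r. Qed.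
Lemma dot_suml (I : Type) (s : seq I) (P : pred I) (F : I -> H) y :
  dot H (\sum_(i <- s | P i) F i) y = \sum_(i <- s | P i) dot H (F i) y.
Proof. exact: linear_sumlz. Qed.
Lemma dot_ge0 x : 0 <= dot H x x.
Proof. by rewrite -normr_dot exprn_ge0. Qed.
Lemma dot_eq0 x : dot H x x = 0 -> x = 0.
Proof. by rewrite -normr_dot => /eqP; rewrite sqrf_eq0 normr_eq0 => /eqP. Qed.

(** The squared norm of |y|^2 x - <x,y> y is nonnegative. That vector is |y|^2
    times the component of x orthogonal to y; the scaling avoids division. *)
Lemma CauchySchwarz_norm x y : `|dot H x y| <= `|x| * `|y|.
Proof.
have [->|y0] := eqVneq y 0; first by rewrite dot0r !normr0 mulr0.
have ny : 0 < `|y| ^+ 2 by rewrite exprn_gt0 ?normr_gt0.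
rewrite -(ler_pXn2r (n:=2)) ?nnegrE ?mulr_ge0// exprMn.
have := dot_ge0 (`|y| ^+ 2 *: x - dot H x y *: y).
rewrite dotBl !dotBr !dotZl !dotZr -!normr_dot (dotC x y).
set d := dot H x y; rewrite normCK.
rewrite rmorphXn /= [(`|y|)^*](CrealP _) ?normr_real//.
set a := `|x| ^+ 2; set b := `|y| ^+ 2.
have -> : b * (b * a) - b * (d^* * d) - (d * (b * d^*) - d * (d^* * b)) =
  b * (a * b - d * d^*) by ring.
by rewrite pmulr_rge0// subr_ge0.
Qed.

Lemma cvg_dotl (u : H^nat) (l y : H) :
  u @ \oo --> l -> dot H (u n) y @[n --> \oo] --> dot H l y.
Proof.
move=> ul; apply/cvgrPdist_lt => e e0.
have y0 : 0 < 1 + `|y| by rewrite ltr_pwDl.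
have /cvgrPdist_lt/(_ _ (divr_gt0 e0 y0)) := ul.
apply: filterS => n; rewrite ltr_pdivlMr// -dotBl; apply: le_lt_trans.
apply: le_trans (CauchySchwarz_norm _ _) _.
by rewrite ler_wpM2l// lerDr.
Qed.

Lemma cvg_dotr (u : H^nat) (l y : H) :
  u @ \oo --> l -> dot H y (u n) @[n --> \oo] --> dot H y l.
Proof.
move=> ul; apply/cvgrPdist_lt => e e0.
have y0 : 0 < 1 + `|y| by rewrite ltr_pwDl.
have /cvgrPdist_lt/(_ _ (divr_gt0 e0 y0)) := ul.
apply: filterS => n; rewrite ltr_pdivlMr// -dotBr; apply: le_lt_trans.
apply: le_trans (CauchySchwarz_norm _ _) _.
by rewrite mulrC ler_wpM2l// lerDr.
Qed.

End InnerProduct.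

Lemma complex_Re_ge0 (R : realType) (z : R[i]) : 0 <= z -> 0 <= complex.Re z.
Proof. by rewrite lecE => /andP[]. Qed.

(** * Linear and symmetric maps *)

Section LinearMaps.
Context {R : realType} {H : hilbert R}.
Implicit Types (A B : H -> H) (x y z : H).

Lemma linear_add A : linear A -> forall x y, A (x + y) = A x + A y.
Proof. by move=> linA x y; rewrite -[x]scale1r linA !scale1r. Qed.

Lemma linear_zero A : linear A -> A 0 = 0.
Proof. by move=> /linear_add linA; apply: (addIr (A 0)); rewrite -linA !add0r. Qed.

Lemma linear_scale A : linear A -> forall a x, A (a *: x) = a *: A x.
Proof. by move=> linA a x; rewrite -[a *: x]addr0 linA linear_zero // addr0. Qed.

Lemma linear_sub A : linear A -> forall x y, A (x - y) = A x - A y.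
Proof.
move=> linA x y.
by rewrite linear_add// -scaleN1r (linear_scale linA) scaleN1r.
Qed.

Definition symmetric_op A := forall x y, dot H (A x) y = dot H x (A y).

(** Polarization: the sesquilinear form g x y = <Ax,y> - <x,Ay> vanishes on the
    diagonal; expanding g at x + y and at x + i y gives g x y + g y x = 0 and
    g x y - g y x = 0. *)
Lemma symmetric_op_real A : linear A ->
  (forall x, dot H (A x) x \is Num.real) -> symmetric_op A.
Proof.
move=> linA realA x y; apply/eqP; rewrite -subr_eq0.
pose g x y := dot H (A x) y - dot H x (A y).
have g0 z : g z z = 0.
  by rewrite /g (dotC (A z) z) (CrealP (realA z)) subrr.
have gxy : g x y + g y x = 0.
  have := g0 (x + y); have := g0 x; have := g0 y.
  rewrite /g !(linear_add linA) !dotDl !dotDr => hy hx hxy.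
  rewrite -[RHS]hxy -[LHS]addr0 -hx -[LHS]addr0 -hy; ring.
have gixy : g x y - g y x = 0.
  have := g0 (x + 'i *: y); have := g0 x; have := g0 y.
  rewrite /g !(linear_add linA) !(linear_scale linA) !dotDl !dotDr !dotZl !dotZr conjCi.
  move=> hy hx hxy.
  apply: (mulfI (neq0Ci _)); rewrite mulr0.
  transitivity (- (0 : R[i]) + 0 - 'i * 'i * 0); last by ring.
  by rewrite -{1}hxy -{1}hx -hy; ring.
have : g x y *+ 2 = 0 by rewrite -[RHS]addr0 -{1}gxy -gixy; ring.
by move=> /eqP; rewrite mulrn_eq0.
Qed.

Lemma positive_op_symmetric A : positive_op A -> symmetric_op A.
Proof. by case=> -[linA _] A0; apply: symmetric_op_real => // x; apply/ger0_real. Qed.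

Lemma symmetric_op_dot_real A x : symmetric_op A -> dot H (A x) x \is Num.real.
Proof. by move=> sA; apply/CrealP; rewrite -dotC sA. Qed.

Lemma bounded_op_comp A B : bounded_op A -> bounded_op B -> bounded_op (A \o B).
Proof.
move=> [lA [M AM]] [lB [N BN]]; split; first by move=> a x y /=; rewrite lB lA.
exists (`|M| * N) => x /=; apply: le_trans (AM _) _.
rewrite rmorphM /= -mulrA; apply: le_trans (_ : `|M|%:C * `|B x| <= _).
  by rewrite ler_wpM2r// lecR ler_norm.
by rewrite ler_wpM2l// lecR.
Qed.

Lemma bounded_op_sub A B : bounded_op A -> bounded_op B -> bounded_op (A - B).
Proof.
move=> [lA [M AM]] [lB [N BN]]; split.
  move=> a x y; rewrite !fctE lB lA scalerBr; rewrite opprD addrACA //.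
exists (M + N) => x; rewrite !fctE; apply: le_trans (ler_normB _ _) _.
by rewrite rmorphD /= mulrDl lerD.
Qed.

Lemma bounded_op_scale a A : bounded_op A -> bounded_op (a *: A).
Proof.
move=> [lA [M AM]]; split.
  by move=> b x y; rewrite !fctE lA scalerDr !scalerA mulrC.
exists (complex.Re `|a| * M) => x; rewrite !fctE normrZ.
have -> : (complex.Re `|a| * M)%:C = `|a| * M%:C.
  by rewrite -[in RHS](RRe_real (normr_real a)) -rmorphM.
by rewrite -mulrA ler_wpM2l.
Qed.

End LinearMaps.

(** * The positive square root of a positive operator *)

Section SquareRoot.
Context {R : realType} {H : hilbert R}.
Implicit Types (A B : H -> H) (x y z : H).

(** The iteration below with the contraction replaced by the number 1: it
    majorizes the norms of the operator iterates and of their increments. *)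
Fixpoint scalar_iter (n : nat) : R :=
  if n is m.+1 then 2^-1 * (1 + scalar_iter m ^+ 2) else 0.

(** A fixed point Y satisfies Y^2 - 2 Y + B = 0, so that (1 - Y)^2 = 1 - B. *)
Fixpoint sqrt_iter B (n : nat) (x : H) : H :=
  if n is m.+1 then 2^-1 *: (B x + sqrt_iter B m (sqrt_iter B m x)) else 0.

Lemma scalar_iter_itv n : 0 <= scalar_iter n <= 1.
Proof.
elim: n => [|n /= /andP[h0 h1]]; first by rewrite /= lexx ler01.
have h2 : scalar_iter n ^+ 2 <= 1 by rewrite expr_le1.
have := sqr_ge0 (scalar_iter n); set s := _ ^+ 2 in h2 *; lra.
Qed.

Lemma scalar_iter_nondecreasing : nondecreasing_seq scalar_iter.
Proof.
apply/nondecreasing_seqP => n; rewrite -subr_ge0 /=.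
suff -> : 2^-1 * (1 + scalar_iter n ^+ 2) - scalar_iter n = 2^-1 * (1 - scalar_iter n) ^+ 2.
  by rewrite mulr_ge0 ?sqr_ge0.
by field.
Qed.

Lemma scalar_iter_is_cvg : cvgn scalar_iter.
Proof.
apply: nondecreasing_is_cvgn; first exact: scalar_iter_nondecreasing.
by exists 1 => _ [n _ <-]; case/andP: (scalar_iter_itv n).
Qed.

Variable B : H -> H.
Hypotheses (linB : linear B) (symB : symmetric_op B) (B1 : forall x, `|B x| <= `|x|).
Local Notation Y := (sqrt_iter B).
Local Notation y_ := scalar_iter.

Lemma sqrt_iter_linear n : linear (Y n).
Proof.
elim: n => [|n IH] a x y /=; first by rewrite scaler0 addr0.
rewrite linB !IH scalerA (mulrC a) -scalerA -scalerDr; congr (_ *: _).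
by rewrite scalerDr addrACA.
Qed.

Lemma sqrt_iter_symmetric n : symmetric_op (Y n).
Proof.
elim: n => [|n IH] x y /=; first by rewrite dot0l dot0r.
by rewrite dotZl dotZr !dotDl !dotDr symB !IH fmorphV rmorph_nat.
Qed.

Lemma sqrt_iter_norm n x : `|Y n x| <= (y_ n)%:C * `|x|.
Proof.
elim: n x => [|n IH] x /=; first by rewrite normr0 mul0r.
have /andP[y0 _] := scalar_iter_itv n.
rewrite normrZ ger0_norm ?invr_ge0 ?ler0n//.
rewrite rmorphM fmorphV rmorph_nat -mulrA ler_wpM2l ?invr_ge0 ?ler0n//.
apply: le_trans (ler_normD _ _) _.
rewrite rmorphD rmorph1 rmorphXn mulrDl mul1r lerD// expr2 -mulrA.
by apply: le_trans (IH _) _; rewrite ler_wpM2l// lecR.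
Qed.

Lemma sqrt_iter_norm1 n x : `|Y n x| <= `|x|.
Proof.
apply: le_trans (sqrt_iter_norm _ _) _.
have /andP[y0 y1] := scalar_iter_itv n.
by rewrite -[leRHS]mul1r ler_wpM2r// -(rmorph1 (real_complex R)) lecR.
Qed.

(** Y_{n+1}^2 - Y_n^2 = Y_{n+1} (Y_{n+1} - Y_n) + (Y_{n+1} - Y_n) Y_n, which
    holds without commutation, mirrors the scalar identity
    y_{n+1}^2 - y_n^2 = y_{n+1} (y_{n+1} - y_n) + (y_{n+1} - y_n) y_n. *)
Lemma sqrt_iter_step n x : `|Y n.+1 x - Y n x| <= (y_ n.+1 - y_ n)%:C * `|x|.
Proof.
elim: n x => [|n IH] x; first by rewrite [Y 0 x]/= !subr0; exact: sqrt_iter_norm.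
have /andP[y0 _] := scalar_iter_itv n.
have /andP[y0' _] := scalar_iter_itv n.+1.
have dy0 : 0 <= y_ n.+1 - y_ n by rewrite subr_ge0 scalar_iter_nondecreasing.
have -> : Y n.+2 x - Y n.+1 x =
    2^-1 *: (Y n.+1 (Y n.+1 x - Y n x) + (Y n.+1 (Y n x) - Y n (Y n x))).
  rewrite (linear_sub (sqrt_iter_linear _)) addrA subrK.
  rewrite [in LHS]/= -scalerBr; congr (_ *: _).
  by rewrite opprD addrACA subrr add0r.
rewrite normrZ ger0_norm ?invr_ge0 ?ler0n//.
have -> : (y_ n.+2 - y_ n.+1)%:C =
    2^-1 * ((y_ n.+1)%:C * (y_ n.+1 - y_ n)%:C + (y_ n.+1 - y_ n)%:C * (y_ n)%:C).
  rewrite -!rmorphM -rmorphD -(rmorph_nat (real_complex R)) -fmorphV -rmorphM.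
  congr (_%:C); transitivity (2^-1 * (1 + y_ n.+1 ^+ 2) - 2^-1 * (1 + y_ n ^+ 2)) => //.
  by move: (y_ n.+1) (y_ n) => u v; field.
rewrite -mulrA ler_wpM2l ?invr_ge0 ?ler0n//.
apply: le_trans (ler_normD _ _) _; rewrite mulrDl lerD//.
  apply: le_trans (sqrt_iter_norm _ _) _; rewrite -mulrA.
  by rewrite ler_wpM2l// lecR.
apply: le_trans (IH _) _; rewrite -mulrA ler_wpM2l ?lecR//.
exact: sqrt_iter_norm.
Qed.

Lemma sqrt_iter_dist n m x : (n <= m)%N ->
  `|Y n x - Y m x| <= (y_ m - y_ n)%:C * `|x|.
Proof.
elim: m => [|m IH]; first by rewrite leqn0 => /eqP ->; rewrite !subrr normr0 mul0r.
rewrite leq_eqVlt => /predU1P[->|]; first by rewrite !subrr normr0 mul0r.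
rewrite ltnS => /IH nm.
rewrite -(subrK (Y m x) (Y n x)) -addrA; apply: le_trans (ler_normD _ _) _.
have -> : y_ m.+1 - y_ n = (y_ m - y_ n) + (y_ m.+1 - y_ m) by ring.
rewrite rmorphD mulrDl lerD// distrC; exact: sqrt_iter_step.
Qed.

Lemma sqrt_iter_cvg x : cvgn (Y ^~ x).
Proof.
apply/cauchy_cvgP/cauchy_exP => e e0.
have e1 : 0 < complex.Re e by move: e0; rewrite ltcE => /andP[].
have eE : e = (complex.Re e)%:C by rewrite RRe_real ?gtr0_real.
have x0 : 0 < 1 + complex.Re `|x|.
  by rewrite ltr_pwDl//; have := normr_ge0 x; rewrite lecE => /andP[].
have d0 : 0 < complex.Re e / (1 + complex.Re `|x|) by rewrite divr_gt0.
have /cvgrPdist_lt/(_ _ d0)[N _ HN] := scalar_iter_is_cvg.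
(* all later iterates stay close to the N-th one *)
exists (Y N x); exists N => // n /= Nn.
rewrite -ball_normE /=; apply: le_lt_trans (sqrt_iter_dist _ Nn) _.
have le_lim := nondecreasing_cvgn_le scalar_iter_nondecreasing scalar_iter_is_cvg.
have := HN N (leqnn N); rewrite /= ger0_norm ?subr_ge0 ?le_lim// => dN.
have dn : y_ n - y_ N < complex.Re e / (1 + complex.Re `|x|).
  by apply: le_lt_trans dN; rewrite lerD2r.
rewrite ltr_pdivlMr// in dn.
rewrite [ltRHS]eE.
apply: (@le_lt_trans _ _ ((y_ n - y_ N) * (1 + complex.Re `|x|))%:C); last first.
  by rewrite ltcR.
have -> : ((y_ n - y_ N) * (1 + complex.Re `|x|))%:C = (y_ n - y_ N)%:C * (1 + `|x|).
  rewrite rmorphM; congr (_ * _).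
  by rewrite rmorphD; congr (_ + _); exact: RRe_real.
by rewrite ler_wpM2l ?lecR ?subr_ge0 ?scalar_iter_nondecreasing// lerDr.
Qed.

Definition sqrt_limit x : H := limn (Y ^~ x).
Local Notation Yoo := sqrt_limit.

Lemma sqrt_limit_cvg x : Y n x @[n --> \oo] --> Yoo x.
Proof. exact: sqrt_iter_cvg. Qed.
Arguments sqrt_limit_cvg : clear implicits.

Lemma sqrt_limit_linear : linear Yoo.
Proof.
move=> a x y; apply: cvg_lim => //.
under eq_cvg do rewrite sqrt_iter_linear.
by apply: cvgD; [apply: cvgZ; [exact: cvg_cst|]|]; exact: sqrt_limit_cvg.
Qed.

Lemma sqrt_limit_symmetric : symmetric_op Yoo.
Proof.
move=> x y; have l1 := cvg_dotl (y := y) (sqrt_limit_cvg x).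
have l2 : dot H (Y n x) y @[n --> \oo] --> dot H x (Yoo y).
  under eq_cvg do rewrite sqrt_iter_symmetric.
  exact: cvg_dotr (sqrt_limit_cvg y).
exact: (norm_cvg_unique l1 l2).
Qed.

Lemma sqrt_limit_norm x : `|Yoo x| <= `|x|.
Proof.
apply/ler_addgt0Pl => e e0.
have /cvgrPdist_lt/(_ _ e0)[n _ /(_ n (leqnn n)) /= dn] := sqrt_limit_cvg x.
rewrite -(subrK (Y n x) (Yoo x)); apply: le_trans (ler_normD _ _) _.
by rewrite lerD ?sqrt_iter_norm1 ?ltW.
Qed.

(** Composition passes to the pointwise limit because the Y_n are uniformly
    contracting: Y_n (Y_n x) - Y_n (Y x) is no longer than Y_n x - Y x. *)
Lemma sqrt_limit_fixpoint x : Yoo x = 2^-1 *: (B x + Yoo (Yoo x)).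
Proof.
have YY : Y n (Y n x) @[n --> \oo] --> Yoo (Yoo x).
  rewrite -[Yoo (Yoo x)]add0r.
  under eq_cvg => n do
    rewrite -[Y n (Y n x)](subrK (Y n (Yoo x))) -(linear_sub (sqrt_iter_linear _)).
  apply: cvgD; last exact: sqrt_limit_cvg.
  apply/cvgr0Pnorm_lt => e e0.
  have /cvgrPdist_lt/(_ _ e0) := sqrt_limit_cvg x.
  apply: filterS => n; apply: le_lt_trans; rewrite distrC.
  exact: sqrt_iter_norm1.
have YS : Y n.+1 x @[n --> \oo] --> Yoo x.
  by rewrite (cvg_shiftS (Y ^~ x)); exact: sqrt_limit_cvg.
apply: (norm_cvg_unique YS).
rewrite /=; apply: cvgZ; [exact: cvg_cst|apply: cvgD; [exact: cvg_cst|exact: YY]].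

Qed.

End SquareRoot.

Section SquareRootExists.
Context {R : realType} {H : hilbert R}.
Implicit Types (A B : H -> H) (x y z : H).

Lemma sqrt_contraction B : linear B -> symmetric_op B ->
  (forall x, `|B x| <= `|x|) ->
  exists S, positive_op S /\ S \o S = (fun x => x - B x).
Proof.
move=> linB symB B1; pose Yo := sqrt_limit B.
have linY : linear Yo by exact: sqrt_limit_linear.
have linS : linear (fun x => x - Yo x).
  by move=> a x y; rewrite linY scalerBr opprD addrACA.
exists (fun x => x - Yo x); split; last first.
  apply/funext => x /=; rewrite (linear_sub linY).
  have e := sqrt_limit_fixpoint linB B1 x; rewrite -/Yo in e.
  have {}e : 2 *: Yo x = B x + Yo (Yo x) by rewrite {1}e scalerA divff ?scale1r ?pnatr_eq0.
  have -> : Yo x - Yo (Yo x) = B x - Yo x.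
    by apply/eqP; rewrite subr_eq addrAC -e scaler_nat mulr2n addrK.
  by rewrite opprB addrA subrK.
split; first split=> //.
  exists 2 => x; apply: le_trans (ler_normB _ _) _.
  by rewrite (rmorph_nat (real_complex R)) mulr_natl mulr2n lerD// sqrt_limit_norm.
move=> x; rewrite dotBl subr_ge0 -normr_dot.
have sY : symmetric_op Yo by exact: sqrt_limit_symmetric.
apply: le_trans (real_ler_norm (symmetric_op_dot_real _ sY)) _.
apply: le_trans (CauchySchwarz_norm _ _) _.
by rewrite expr2 ler_wpM2r// sqrt_limit_norm.
Qed.

(** With M a bound of A and a = 1/M, the operator B = 1 - a A is a contraction:
    positivity of A at x - a A x gives a <Ax,Ax> <= <Ax,x>, hence
    |Bx|^2 <= |x|^2. If S is a root of 1 - B = a A, then sqrt(M) S is one of A. *)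
Lemma sqrt_op_exists A : positive_op A -> exists S, positive_op S /\ S \o S = A.
Proof.
move=> pA; have symA := positive_op_symmetric pA.
case: (pA) => -[linA [M0 AM0]] A0.
pose M := `|M0| + 1.
have M_gt0 : 0 < M by rewrite ltr_wpDl.
have MC_gt0 : 0 < M%:C by rewrite ltcR.
have AM x : `|A x| <= M%:C * `|x|.
  apply: le_trans (AM0 _) _; rewrite ler_wpM2r// lecR /M.
  by apply: le_trans (ler_norm _) _; rewrite lerDl.
have M_neq0 : M%:C != 0 by rewrite gt_eqF.
pose a : R[i] := (M%:C)^-1.
have a_gt0 : 0 < a by rewrite invr_gt0.
have a_real : a^* = a by apply/CrealP/gtr0_real.
pose B x := x - a *: A x.
have linB : linear B.
  move=> b x y; rewrite /B linA !scalerDr !scalerA (mulrC a) opprD addrACA -scalerA.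
  by rewrite -scalerN -scalerN scalerA.
have symB : symmetric_op B.
  by move=> x y; rewrite /B dotBl dotBr dotZl dotZr a_real symA.
have B1 x : `|B x| <= `|x|.
  rewrite -(ler_pXn2r (n:=2)) ?nnegrE// !normr_dot /B.
  rewrite dotBl !dotBr !dotZl !dotZr a_real -(symA x x).
  have h1 : dot H (A (A x)) (A x) <= M%:C * dot H (A x) (A x).
    apply: le_trans (real_ler_norm (symmetric_op_dot_real _ symA)) _.
    apply: le_trans (CauchySchwarz_norm _ _) _.
    by rewrite -normr_dot expr2 mulrA ler_wpM2r.
  have := A0 (x - a *: A x).
  rewrite (linear_sub linA) (linear_scale linA) dotBl !dotBr !dotZl !dotZr a_real.
  rewrite (symA (A x) x) => h2.
  have h3 : a * (a * dot H (A (A x)) (A x)) <= a * dot H (A x) (A x).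
    apply: ler_wpM2l; first exact: ltW.
    by rewrite -[leRHS](mulKf M_neq0); apply: ler_wpM2l; first exact: ltW.
  have h4 : 0 <= dot H (A x) x - a * dot H (A x) (A x).
    apply: le_trans h2 _; rewrite -subr_ge0 in h3; rewrite -subr_ge0.
    by rewrite (_ : _ - _ = a * dot H (A x) (A x) - a * (a * dot H (A (A x)) (A x))) //; ring.
  rewrite -subr_ge0.
  set p := dot H (A x) x; set q := dot H (A x) (A x).
  rewrite (_ : _ - _ = a * p + a * (p - a * q)); last by ring.
  have p0 : 0 <= p by exact: A0.
  by rewrite addr_ge0// mulr_ge0// ltW.
have [S [[[linS [N SN]] S0] SS]] := sqrt_contraction linB symB B1.
pose b : R[i] := (Num.sqrt M)%:C.
have b_ge0 : 0 <= b by rewrite lecR sqrtr_ge0.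
have bb : b * b = M%:C by rewrite -rmorphM -expr2 sqr_sqrtr// ltW.
exists (b *: S); split; last first.
  apply/funext => x /=; rewrite !fctE (linear_scale linS) scalerA bb.
  have -> : S (S x) = x - B x by rewrite -[LHS]/((S \o S) x) SS.
  by rewrite /B opprB addrC subrK scalerA divff ?scale1r.
split; first by apply: bounded_op_scale; split=> //; exists N.
by move=> x; rewrite fctE dotZl mulr_ge0.
Qed.

End SquareRootExists.

(** * Orthonormal bases and the trace *)

Section Trace.
Context {R : realType} {H : hilbert R}.
Implicit Types (A B S : H -> H) (E : set H) (x y z : H).

Lemma sqrt_opP A : positive_op A ->
  positive_op (sqrt_op A) /\ sqrt_op A \o sqrt_op A = A.
Proof. by move=> /sqrt_op_exists; exact: xgetPex. Qed.

Definition orthonormal_set E :=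
  (forall e, E e -> dot H e e = 1) /\
  (forall e f, E e -> E f -> e <> f -> dot H e f = 0).

(** Zorn's lemma gives a maximal orthonormal set; normalizing a nonzero vector
    orthogonal to it would give a larger one. *)
Lemma orthonormal_basis_exists : exists E : set H, orthonormal_basis E.
Proof.
have [F FP totF|E [[E1 E0] maxE]] := @Zorn_bigcup H orthonormal_set.
  split=> [e [X /FP[X1 _] /X1//]|e f [X FX Xe] [Y FY Yf]].
  have [XY|YX] := totF _ _ FX FY.
    by have [_ Y0] := FP _ FY; apply: Y0 => //; apply: XY.
  by have [_ X0] := FP _ FX; apply: X0 => //; apply: YX.
exists E; split=> // x xE; apply: contrapT => /eqP x0.
have nx : `|x| != 0 by rewrite normr_eq0.
pose u := `|x|^-1 *: x.
have ortho e : E e -> dot H u e = 0 by move=> Ee; rewrite dotZl xE ?mulr0.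
have ortho' e : E e -> dot H e u = 0 by move=> Ee; rewrite dotC ortho ?conjC0.
have u1 : dot H u u = 1.
  rewrite dotZl dotZr -normr_dot (CrealP _) ?realV ?normr_real//.
  by rewrite expr2 mulKf ?mulVf.
apply: (maxE (E `|` [set u])).
  split=> [e Ee|/(_ u (or_intror erefl)) Eu]; first by left.
  by have := oner_neq0 R[i]; rewrite -u1 ortho// eqxx.
split=> [e [/E1//|->//]|e f [Ee|->] [Ef|->] //].
- exact: E0.
- by rewrite ortho'.
- by rewrite ortho.
Qed.

Lemma some_onbP : orthonormal_basis (some_onb : set H).
Proof. by have [E EP] := orthonormal_basis_exists; apply: (xgetPex _ (ex_intro _ E EP)). Qed.

(** Bessel's inequality. In the induction the component of x along the head e
    is removed, which leaves the other coefficients unchanged. *)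
Lemma bessel (s : seq H) x : uniq s ->
  (forall e, e \in s -> dot H e e = 1) ->
  (forall e f, e \in s -> f \in s -> e <> f -> dot H e f = 0) ->
  \sum_(e <- s) `|dot H x e| ^+ 2 <= dot H x x.
Proof.
elim: s x => [|e s IH] x /=; first by rewrite big_nil dot_ge0.
move=> /andP[es us] n1 o; rewrite big_cons.
pose x' := x - dot H x e *: e.
have ee : dot H e e = 1 by apply: n1; rewrite mem_head.
have x'x' : dot H x' x' = dot H x x - `|dot H x e| ^+ 2.
  rewrite dotBl !dotBr !dotZl !dotZr ee (dotC x e) normCK; ring.
have /(_ x') := IH _ us; rewrite x'x' lerBrDl => le.
apply: le_trans (le _ _) => [|f fs|f g fs gs]; last 2 first.
- by apply: n1; rewrite inE fs orbT.
- by apply: o; rewrite inE ?fs ?gs orbT.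
rewrite lerD2l le_eqVlt; apply/orP; left; apply/eqP.
rewrite big_seq [RHS]big_seq; apply: eq_bigr => f fs.
have ef0 : dot H e f = 0.
  by apply: o; rewrite ?inE ?eqxx ?fs ?orbT// => ef; rewrite ef fs in es.
by rewrite dotBl dotZl ef0 mulr0 subr0.
Qed.

Lemma trace_ge0 A : (forall x, 0 <= dot H (A x) x) -> (0 <= trace A)%E.
Proof.
by move=> A0; apply: esum_ge0 => e _; rewrite lee_fin complex_Re_ge0.
Qed.

Lemma trace0 : trace (0 : H -> H) = 0%E.
Proof. by apply: esum1 => e _; rewrite dot0l. Qed.

Lemma trace_add A B : (forall x, 0 <= dot H (A x) x) -> (forall x, 0 <= dot H (B x) x) ->
  trace (A + B) = (trace A + trace B)%E.
Proof.
move=> A0 B0; rewrite -esumD; first last.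
- by move=> e _; rewrite lee_fin complex_Re_ge0.
- by move=> e _; rewrite lee_fin complex_Re_ge0.
by apply: eq_esum => e _; rewrite fctE dotDl raddfD.
Qed.

Lemma trace_sum (I : choiceType) (s : seq I) (F : I -> H -> H) :
  (forall i x, 0 <= dot H (F i x) x) ->
  trace (\sum_(i <- s) F i) = (\sum_(i <- s) trace (F i))%E.
Proof.
move=> F0; elim: s => [|i s IH]; first by rewrite !big_nil trace0.
rewrite !big_cons trace_add// ?IH// => x.
by rewrite fct_sumE dot_suml sumr_ge0.
Qed.

Lemma trace_scale (c : R) A : 0 <= c -> (forall x, 0 <= dot H (A x) x) ->
  trace (c%:C *: A) = (c%:E * trace A)%E.
Proof.
rewrite le_eqVlt => /predU1P[<- _|c0 A0].
  by rewrite mul0e scale0r trace0.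
rewrite /trace /esum -ereal_sup_pZl// image_comp; congr (ereal_sup _).
apply: eq_imagel => X _ /=; rewrite ge0_mule_fsumr; last first.
  by move=> e; rewrite lee_fin complex_Re_ge0.
apply: eq_fsbigr => e _; rewrite fctE dotZl -EFinM; congr (_%:E).
by rewrite -[dot H (A e) e]RRe_real ?ger0_real// -rmorphM.
Qed.

End Trace.

(** * Orthogonal projections *)

Section Projections.
Context {R : realType} {H : hilbert R}.
Implicit Types (V : set H) (x y z : H).

Lemma orthogonal_projection_unique V (P : H -> H) x u :
  closed_subspace V -> orthogonal_projection V P ->
  V u -> (forall y, V y -> dot H (x - u) y = 0) -> P x = u.
Proof.
move=> [_ linV _] projP Vu xu; have [VP xP] := projP x.
have Vd : V (P x - u) by rewrite addrC -scaleN1r; exact: linV.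
apply/eqP; rewrite -subr_eq0; apply/eqP/dot_eq0.
rewrite -[in X in dot H X _](subrK x (P x)) -addrA addrC -[P x - x]opprB dotBl.
by rewrite xu// xP// subr0.
Qed.

Variables (V : set H) (P : H -> H).
Hypotheses (cV : closed_subspace V) (projP : orthogonal_projection V P).

Lemma projection_linear : linear P.
Proof.
move=> a x y; have [_ linV _] := cV.
have [Vx xP] := projP x; have [Vy yP] := projP y.
apply: (orthogonal_projection_unique cV projP); first exact: linV.
move=> z Vz; rewrite opprD addrACA -scalerBr dotDl dotZl xP// yP//.
by rewrite mulr0 addr0.
Qed.

Lemma projection_dot x y : dot H (P x) y = dot H (P x) (P y).
Proof.
have [Vx _] := projP x; have [_ yP] := projP y.
by apply/eqP; rewrite -subr_eq0 -dotBr dotC yP// conjC0.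
Qed.

Lemma projection_ge0 x : 0 <= dot H (P x) x.
Proof. by rewrite projection_dot dot_ge0. Qed.

Lemma projection_co_ge0 x : 0 <= dot H (x - P x) x.
Proof.
suff -> : dot H (x - P x) x = dot H (x - P x) (x - P x) by exact: dot_ge0.
by have [Vx xP] := projP x; rewrite [RHS]dotBr (xP _ Vx) subr0.
Qed.

Lemma projection_bounded : bounded_op P.
Proof.
split; first exact: projection_linear.
exists 1 => x; rewrite mul1r -(ler_pXn2r (n:=2)) ?nnegrE// !normr_dot.
by rewrite -projection_dot -subr_ge0 -dotBl projection_co_ge0.
Qed.

End Projections.

(** * The greedy trace estimate *)

Section Greedy.
Context {R : realType} {H : hilbert R} {T : rooted_tree} (W : packet_tree H T).
Implicit Types (A : H -> H) (x : H).

Lemma packet_proj_component n (u : T -> H) w :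
  (forall v, v \in level T n -> packet W v (u v)) -> w \in level T n ->
  packet_proj W w (\sum_(v <- level T n) u v) = u w.
Proof.
move=> Wu wn; have [ortho _] := packet_level W n.
apply: (orthogonal_projection_unique (packet_closed W w) (packet_projP W w)); first exact: Wu.
move=> y Wy; rewrite (bigD1_seq w)//= addrAC subrr add0r dot_suml big1_seq// => v.
by move=> /andP[/eqP vw vs]; apply: (ortho v w) => //; exact: Wu.
Qed.

Lemma packet_proj_sum n x : \sum_(w <- level T n) packet_proj W w x = x.
Proof.
have [_ setTE] := packet_level W n.
have : [set: H] x by [].
rewrite setTE => -[u Wu xE]; rewrite [RHS]xE big_seq [RHS]big_seq.
by apply: eq_bigr => w wn; rewrite xE packet_proj_component.
Qed.

Lemma content_dot A x w : positive_op A ->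
  dot H (Defs.content W w A x) x = dot H (packet_proj W w (sqrt_op A x)) (sqrt_op A x).
Proof. by move=> /sqrt_opP[/positive_op_symmetric symS _]; rewrite /Defs.content /= symS. Qed.

Lemma content_ge0 A x w : positive_op A -> 0 <= dot H (Defs.content W w A x) x.
Proof.
by move=> pA; rewrite content_dot//; apply/projection_ge0/packet_projP.
Qed.

(** The packet contents at a given depth decompose A itself: they are the terms
    of S (sum_w P_w) S = S S. *)
Lemma content_sum A n : positive_op A -> \sum_(w <- level T n) Defs.content W w A = A.
Proof.
move=> /sqrt_opP[[[linS _] _] SS]; apply/funext => x.
rewrite fct_sumE -[RHS](congr1 (@^~ x) SS) /= -[in RHS](packet_proj_sum n (sqrt_op A x)).
elim/big_ind2 : _ => [|u1 v1 u2 v2 -> ->|//]; first by rewrite linear_zero.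
by rewrite linear_add.
Qed.

(** The remainder is S (1 - P_w) S. *)
Lemma remainder_positive A w : positive_op A -> positive_op (A - Defs.content W w A).
Proof.
move=> pA; have [[bS _] SS] := sqrt_opP pA; split.
  apply: bounded_op_sub; first by case: pA.
  apply: bounded_op_comp => //; apply: bounded_op_comp => //.
  exact: projection_bounded (packet_closed W w) (packet_projP W w).
move=> x; rewrite fctE dotBl content_dot//.
have [/positive_op_symmetric symS _] := sqrt_opP pA.
rewrite -{1}SS /= symS -dotBl.
exact: projection_co_ge0 (packet_projP W w) _.
Qed.

Lemma decay_rate_ge0 n : level T n != fset0%fset -> 0 <= decay_rate R T n.
Proof. by rewrite -cardfs_gt0 => N0; rewrite subr_ge0 invf_le1 ?ler1n ?ltr0n. Qed.

(** The maximum of N contents is at least their average tr A / N. When tr A is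
    infinite the right-hand side is infinite too, except for N = 1, where the
    rate vanishes and so does the remainder. *)
Lemma greedy_step_trace n A w : positive_op A -> w \in level T n ->
  (forall v, v \in level T n ->
     (trace (Defs.content W v A) <= trace (Defs.content W w A))%E) ->
  (trace (A - Defs.content W w A)%R <= (decay_rate R T n)%:E * trace A)%E.
Proof.
move=> pA wn maxw; rewrite /decay_rate; set N := #|` level T n|.
have N_gt0 : (0 < N)%N by rewrite cardfs_gt0; apply/fset0Pn; exists w.
have pB := remainder_positive w pA.
have trA : trace A = (trace (A - Defs.content W w A)%R + trace (Defs.content W w A))%E.
  by rewrite -trace_add ?subrK//; [case: pB|move=> x; exact: content_ge0].
have tB0 : (0 <= trace (A - Defs.content W w A)%R)%E by apply: trace_ge0; case: pB.
have tC0 v : (0 <= trace (Defs.content W v A))%E by apply: trace_ge0 => x; exact: content_ge0.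
have tA0 : (0 <= trace A)%E by apply: trace_ge0; case: pA.
have trAs : trace A = (\sum_(v <- level T n) trace (Defs.content W v A))%E.
  by rewrite -[in LHS](content_sum n pA) trace_sum// => v x; exact: content_ge0.
have [fA|] := boolP (trace A \is a fin_num); last first.
  rewrite ge0_fin_numE// -leNgt leye_eq => /eqP Aoo.
  have [N1|N1] := eqVneq N 1%N; last first.
    rewrite Aoo gt0_muley ?leey// lte_fin subr_gt0 invf_lt1 ?ltr0n// ltr1n.
    by rewrite ltn_neqAle eq_sym N1.
  have -> : A - Defs.content W w A = 0.
    have := content_sum n pA; have /eqP/cardfs1P[v lv] := N1.
    by move: wn; rewrite lv inE => /eqP ->; rewrite big_seq_fset1 => ->; rewrite subrr.
  by rewrite trace0 N1 invr1 subrr mul0e.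
have fC : trace (Defs.content W w A) \is a fin_num.
  rewrite ge0_fin_numE//; apply: le_lt_trans (_ : _ <= trace A)%E _.
    by rewrite trA leeDr.
  by rewrite ltey_eq fA.
have fB : trace (A - Defs.content W w A)%R \is a fin_num.
  rewrite ge0_fin_numE//; apply: le_lt_trans (_ : _ <= trace A)%E _.
    by rewrite trA leeDl.
  by rewrite ltey_eq fA.
have leN : (trace A <= (N%:R)%:E * trace (Defs.content W w A))%E.
  rewrite trAs -(fineK fC) -EFinM mulr_natl.
  have -> : (fine (trace (Defs.content W w A)) *+ N)%:E =
      (\sum_(v <- level T n) (fine (trace (Defs.content W w A)))%:E)%E.
    by rewrite sumEFin big_const_seq count_predT iter_addr_0.
  by rewrite big_seq [leRHS]big_seq; apply: lee_sum => v vn; rewrite fineK// maxw.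
move: trA leN; rewrite -(fineK fC) -(fineK fB) -(fineK fA).
rewrite -EFinD -!EFinM !lee_fin => -[->].
set b := fine (trace (_ - _)); set c := fine _ => le.
have N0 : 0 < N%:R :> R by rewrite ltr0n.
have h : (b + c) / N%:R <= c by rewrite ler_pdivrMr// mulrC.
by rewrite mulrBl mul1r [N%:R^-1 * _]mulrC; lra.
Qed.

Lemma greedy_trace_bound n A r : positive_op A -> greedy_sequence W n A r ->
  forall k, positive_op (r k) /\ (trace (r k) <= (decay_rate R T n ^+ k)%:E * trace A)%E.
Proof.
move=> pA [r0 rS]; elim=> [|k [pk IH]]; first by rewrite r0 mul1e.
have [w [wn maxw ->]] := rS k; split; first exact: remainder_positive.
apply: le_trans (greedy_step_trace pk wn maxw) _.
rewrite exprS EFinM -muleA lee_wpmul2l// lee_fin; apply: decay_rate_ge0.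
by apply/fset0Pn; exists w.
Qed.

End Greedy.

(** * Rank-one projections *)

Section RankOne.
Context {R : realType} {H : hilbert R}.
Implicit Types (A B S : H -> H) (x y u : H).

Definition rank_one x : H -> H := fun u => dot H u x *: x.

(** The zero vector is allowed so that the extremal operator below makes sense
    also when some packet is trivial. *)
Variable x : H.
Hypothesis x01 : dot H x x = 1 \/ x = 0.
Local Notation A := (rank_one x).

Lemma rank_one_linear : linear A.
Proof. by move=> a u v; rewrite /rank_one dotDl dotZl scalerDl scalerA. Qed.

Lemma rank_one_bounded : bounded_op A.
Proof.
split; first exact: rank_one_linear.
exists (complex.Re (dot H x x)) => u; rewrite RRe_real ?ger0_real ?dot_ge0//.
rewrite normrZ -normr_dot expr2 mulrC -mulrA (mulrC (`|x|) (`|u|)).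
by rewrite ler_wpM2l// CauchySchwarz_norm.
Qed.

Lemma rank_one_dot u : dot H (A u) u = `|dot H u x| ^+ 2.
Proof. by rewrite dotZl (dotC u x) normCK. Qed.

Lemma rank_one_positive (c : R) : 0 <= c -> positive_op (c%:C *: A).
Proof.
move=> c0; split; first exact/bounded_op_scale/rank_one_bounded.
by move=> u; rewrite fctE dotZl rank_one_dot mulr_ge0 ?exprn_ge0// lecR.
Qed.

Lemma rank_one_idempotent : A \o A = A.
Proof.
apply/funext => u /=; rewrite /rank_one dotZl.
by case: x01 => [->|->]; rewrite ?mulr1// !scaler0.
Qed.

(** |Su|^2 = <S S u, u> = c |<u,x>|^2, so S kills the vectors orthogonal to x,
    and S = 0 if c = 0. If c > 0 then S, which commutes with S S = c A, maps x to
    a nonnegative multiple of x, whose factor must be the square root of c. *)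
Lemma rank_one_sqrt_unique (c : R) S : 0 <= c -> positive_op S ->
  S \o S = c%:C *: A -> S = (Num.sqrt c)%:C *: A.
Proof.
move=> c0 pS SS; have symS := positive_op_symmetric pS.
case: (pS) => -[linS _] S0.
have SSE u : S (S u) = c%:C *: A u by rewrite -[LHS]/((S \o S) u) SS.
have Sker u : c%:C * `|dot H u x| ^+ 2 = 0 -> S u = 0.
  move=> cu; apply: dot_eq0; rewrite -symS SSE dotZl rank_one_dot //.
have [c00|cn0] := eqVneq c 0.
  rewrite c00 sqrtr0 scale0r; apply/funext => u; apply: Sker.
  by rewrite c00 mul0r.
case: x01 => [x1|x0]; last first.
  apply/funext => u; rewrite Sker ?x0 ?dot0r ?normr0 ?expr0n ?mulr0//.
  by rewrite fctE /rank_one scaler0 scaler0.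
have Ax : A x = x by rewrite /rank_one x1 scale1r.
have cC0 : c%:C != 0 by rewrite fmorph_eq0.
have Sx : S x = dot H (S x) x *: x.
  by apply: (scalerI cC0); rewrite -(linear_scale linS) -[in LHS]Ax -SSE SSE.
have Sxx : dot H (S x) x = (Num.sqrt c)%:C.
  apply/eqP; rewrite -(eqrXn2 (n:=2))// ?lecR ?sqrtr_ge0//.
  rewrite -rmorphXn /= sqr_sqrtr//.
  have := congr1 (fun z => dot H z x) (SSE x).
  by rewrite Ax Sx (linear_scale linS) Sx scalerA !dotZl x1 !mulr1 expr2 => ->.
apply/funext => u; rewrite fctE.
have := Sker (u - dot H u x *: x).
rewrite dotBl dotZl x1 mulr1 subrr normr0 expr0n mulr0 => /(_ erefl)/eqP.
rewrite (linear_sub linS) subr_eq0 => /eqP ->.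
by rewrite (linear_scale linS) Sx Sxx !scalerA mulrC.
Qed.

Lemma rank_one_sqrt (c : R) : 0 <= c -> sqrt_op (c%:C *: A) = (Num.sqrt c)%:C *: A.
Proof.
move=> c0; have [pS SS] := sqrt_opP (rank_one_positive c0).
exact: rank_one_sqrt_unique.
Qed.

Lemma rank_one_adjoint : adjoint A = A.
Proof.
have adjA : bounded_op A /\ forall u v, dot H (A u) v = dot H u (A v).
  split; first exact: rank_one_bounded.
  by move=> u v; rewrite dotZl dotZr -dotC mulrC.
have [_ adjP] : bounded_op (adjoint A) /\ forall u v, dot H (A u) v = dot H u (adjoint A v).
  apply: (@xgetPex _ 0 [set B : H -> H | bounded_op B /\
    forall u v, dot H (A u) v = dot H u (B v)]); by exists A.
apply/funext => v; apply/eqP; rewrite -subr_eq0; apply/eqP/dot_eq0.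
by rewrite dotBr -adjP adjA.2 subrr.
Qed.

Lemma rank_one_abs : abs_op A = A.
Proof.
rewrite /abs_op rank_one_adjoint rank_one_idempotent.
by have := rank_one_sqrt ler01; rewrite !scale1r sqrtr1 scale1r.
Qed.

Lemma rank_one_trace_lty : (trace A < +oo)%E.
Proof.
apply: le_lt_trans (ltry (complex.Re (dot H x x))).
have [E1 E0 _] := @some_onbP R H.
apply: ge_ereal_sup => _ [X [finX XE] <-].
rewrite fsbig_finite//= sumEFin lee_fin -lecR RRe_real ?ger0_real ?dot_ge0//.
have XsE e : e \in fset_set X -> some_onb e by rewrite in_fset_set// inE => /XE.
rewrite rmorph_sum /=.
apply: le_trans (bessel x (fset_uniq (fset_set X)) _ _) => [|e /XsE|e f /XsE Ee /XsE Ef].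
- apply: ler_sum => e _; rewrite rank_one_dot RRe_real ?rpredX ?normr_real//.
  by rewrite (dotC x e) norm_conjC.
- exact: E1.
- exact: E0.
Qed.

(** A nonzero x has a nonzero coefficient on some vector of an orthonormal
    basis. *)
Lemma rank_one_trace_gt0 : x != 0 -> (0 < trace A)%E.
Proof.
move=> xn0; have [_ _ E0] := @some_onbP R H.
have [e Ee xe] : exists2 e, (some_onb : set H) e & dot H x e != 0.
  apply: contrapT => no; move/eqP: xn0; apply; apply: E0 => e Ee.
  by apply/eqP; apply: contrapT => /negP xe; apply: no; exists e.
apply: lt_le_trans (_ : (complex.Re (dot H (A e) e))%:E <= _)%E.
  rewrite lte_fin -ltcR rank_one_dot RRe_real ?rpredX ?normr_real//.
  by rewrite exprn_gt0// normr_gt0 dotC conjC_eq0.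
apply: esum_ge; exists [set e].
  by split=> // f ->.
by rewrite fsbig_set1.
Qed.

End RankOne.

(** * Extremal remainders *)

Section Extremal.
Context {R : realType} {H : hilbert R} {T : rooted_tree} (W : packet_tree H T).
Implicit Types (x : H) (n : nat).

(** All packets of depth n carry the same share 1/N of the energy of x, so that
    greedy selection has no packet to prefer. *)
Definition equidistributed n x := (dot H x x = 1 \/ x = 0) /\
  forall w, w \in level T n ->
    dot H (packet_proj W w x) x = (#|` level T n|%:R^-1) * dot H x x.

Lemma packet_unit_vector w : packet W w <> [set 0] ->
  exists2 e, packet W w e & dot H e e = 1.
Proof.
have [V0 linV _] := packet_closed W w => Vn0.
have [v Vv v0] : exists2 v, packet W w v & v != 0.
  apply: contrapT => no; apply: Vn0; apply/seteqP; split=> [v Vv|_ ->//].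
  by apply: contrapT => /eqP v0; apply: no; exists v.
exists (`|v|^-1 *: v); first by rewrite -[_ *: _]addr0; exact: linV.
have nv : `|v| != 0 by rewrite normr_eq0.
rewrite dotZl dotZr -normr_dot (CrealP _) ?realV ?normr_real//.
by rewrite expr2 mulKf ?mulVf.
Qed.

Lemma equidistributed_unit n : nonzero_packets W n ->
  exists2 x, equidistributed n x & dot H x x = 1.
Proof.
move=> [N_gt0 Wn0]; set N := #|` level T n| in N_gt0 *.
have [e eP] : {e : T -> H & forall w, w \in level T n ->
    packet W w (e w) /\ dot H (e w) (e w) = 1}.
  apply: (@choice _ _ (fun w e => w \in level T n -> packet W w e /\ dot H e e = 1)) => w.
  case: (boolP (w \in level T n)) => [wn|_]; last by exists 0.
  by have [e We e1] := packet_unit_vector (Wn0 w wn); exists e.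
pose b : R[i] := (Num.sqrt N%:R)^-1%:C.
have bb : b * b^* = N%:R^-1.
  rewrite (CrealP _); last by apply: ger0_real; rewrite lecR invr_ge0 sqrtr_ge0.
  rewrite /b -rmorphM -invfM -expr2 sqr_sqrtr ?ler0n// fmorphV.
  by rewrite rmorph_nat.
pose x := \sum_(w <- level T n) b *: e w.
have Px w : w \in level T n -> packet_proj W w x = b *: e w.
  move=> wn; rewrite /x (packet_proj_component (u := fun w => b *: e w))// => v vn.
  have [V0 linV _] := packet_closed W v.
  by rewrite -[_ *: _]addr0; apply: linV => //; have [] := eP v vn.
have Pxx w : w \in level T n -> dot H (packet_proj W w x) x = N%:R^-1.
  move=> wn; rewrite (projection_dot (packet_projP W w)) Px// dotZl dotZr.
  by have [_ ->] := eP w wn; rewrite mulr1 bb.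
have xx : dot H x x = 1.
  rewrite -{1}(packet_proj_sum W n x) dot_suml big_seq.
  under eq_bigr => w wn do rewrite Pxx//.
  rewrite -big_seq big_const_seq count_predT iter_addr_0 -[LHS]mulr_natl divff//.
  by rewrite pnatr_eq0 -lt0n.
by exists x => //; split; [left|move=> w wn; rewrite xx mulr1 Pxx].
Qed.

Lemma equidistributed_exists n :
  exists x, equidistributed n x /\ (nonzero_packets W n -> dot H x x = 1).
Proof.
have [/equidistributed_unit[x ex x1]|no] := pselect (nonzero_packets W n).
  by exists x.
exists 0; split=> //; split; first by right.
by move=> w _; rewrite !dot0r mulr0.
Qed.

(** With A the rank-one projection, (sqrt c A) P_w (sqrt c A) = c <P_w x, x> A. *)
Lemma rank_one_content n x w (c : R) : 0 <= c -> equidistributed n x ->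
  w \in level T n ->
  Defs.content W w (c%:C *: rank_one x) = (c * #|` level T n|%:R^-1)%:C *: rank_one x.
Proof.
move=> c0 [x01 eqx] wn; apply/funext => u.
rewrite /Defs.content /= rank_one_sqrt// !fctE /rank_one.
have linP := projection_linear (packet_closed W w) (packet_projP W w).
rewrite !scalerA (linear_scale linP) dotZl eqx//.
case: x01 => [->|->]; last by rewrite !scaler0.
congr (_ *: _); rewrite mulr1 rmorphM fmorphV rmorph_nat.
transitivity (c%:C / #|` level T n|%:R * dot H u x) => //.
have <- : (Num.sqrt c)%:C * (Num.sqrt c)%:C = c%:C by rewrite -rmorphM -expr2 sqr_sqrtr.
ring.
Qed.

Lemma decay_rate_complex n : decay_rate R[i] T n = (decay_rate R T n)%:C.
Proof. by rewrite /decay_rate rmorphB rmorph1 fmorphV rmorph_nat. Qed.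

Lemma rank_one_step n x w (c : R) : 0 <= c -> equidistributed n x -> w \in level T n ->
  c%:C *: rank_one x - Defs.content W w (c%:C *: rank_one x) =
  (decay_rate R T n * c)%:C *: rank_one x.
Proof.
move=> c0 ex wn; rewrite (rank_one_content c0 ex wn) -scalerBl -rmorphB.
by congr (_%:C *: _); rewrite /decay_rate mulrBl mul1r mulrC.
Qed.

Lemma rank_one_greedy n x r : equidistributed n x ->
  greedy_sequence W n (rank_one x) r ->
  forall k, 0 <= decay_rate R T n ^+ k /\ r k = (decay_rate R T n ^+ k)%:C *: rank_one x.
Proof.
move=> ex [r0 rS]; elim=> [|k [c0 IH]]; first by rewrite expr0 ler01 r0 scale1r.
have [w [wn _ ->]] := rS k; rewrite exprS IH (rank_one_step c0 ex wn); split=> //.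
by rewrite mulr_ge0//; apply: decay_rate_ge0; apply/fset0Pn; exists w.
Qed.

Lemma rank_one_greedy_exists n x : equidistributed n x -> (0 < #|` level T n|)%N ->
  greedy_sequence W n (rank_one x) (fun k => (decay_rate R T n ^+ k)%:C *: rank_one x).
Proof.
move=> ex N0; split; first by rewrite expr0 scale1r.
have l0 : level T n != fset0%fset by rewrite -cardfs_gt0.
have [w wn] := fset0Pn _ l0 => k; exists w.
have c0 : 0 <= decay_rate R T n ^+ k by rewrite exprn_ge0// decay_rate_ge0.
split=> // [v vn|]; last by rewrite (rank_one_step c0 ex wn) exprS.
by rewrite (rank_one_content c0 ex wn) (rank_one_content c0 ex vn).
Qed.

Lemma rank_one_trace_class x : dot H x x = 1 \/ x = 0 -> trace_class (rank_one x).
Proof.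
move=> x01; split; first exact: rank_one_bounded.
by rewrite rank_one_abs// rank_one_trace_lty.
Qed.

End Extremal.

Theorem proposition4p3 (R : realType) (H : hilbert R) (T : rooted_tree)
    (W : packet_tree H T) :
  (forall (n : nat) (A : H -> H) (r : nat -> H -> H),
     (1 <= n)%N -> positive_op A -> trace_class A -> greedy_sequence W n A r ->
     forall k, (trace (r k) <= (decay_rate R T n ^+ k)%:E * trace A)%E) /\
  forall n : nat, (1 <= n)%N ->
    (exists A : H -> H,
       [/\ positive_op A,
           trace_class A,
           nonzero_packets W n -> A <> 0,
           (0 < #|` level T n|)%N -> exists r, greedy_sequence W n A r &
           forall r, greedy_sequence W n A r -> forall k,
             r k = decay_rate R[i]%C T n ^+ k *: A /\
             (trace (r k) = (decay_rate R T n ^+ k)%:E * trace A)%E]) /\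
    (nonzero_packets W n -> forall c : R,
       (forall (A : H -> H) (r : nat -> H -> H),
          positive_op A -> trace_class A -> greedy_sequence W n A r ->
          forall k, (trace (r k) <= (c ^+ k)%:E * trace A)%E) ->
       decay_rate R T n <= c).
Proof.
split=> [n A r _ pA _ gr k|n _].
  exact: (greedy_trace_bound pA gr k).2.
have pA1 x : positive_op (rank_one x : H -> H).
  by rewrite -[rank_one x]scale1r; apply: (rank_one_positive x ler01).
split.
  have [x [ex xn]] := equidistributed_exists W n.
  exists (rank_one x); split=> //.
  - exact: rank_one_trace_class ex.1.
  - move=> /xn x1 /(congr1 (fun A => dot H (A x) x)).
    by rewrite dotZl x1 mulr1 dot0l => /eqP; rewrite oner_eq0.
  - by move=> N0; eexists; exact: rank_one_greedy_exists.
  move=> r /(rank_one_greedy ex) gr k; have [c0 rk] := gr k.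
  rewrite decay_rate_complex -rmorphXn rk; split=> //.
  by apply: trace_scale => //; case: (pA1 x).
move=> nz c cP; have [x ex x1] := equidistributed_unit nz.
have gr := rank_one_greedy_exists ex nz.1.
have tC := rank_one_trace_class ex.1.
have := cP _ _ (pA1 x) tC gr 1%N.
have [c0 _] := rank_one_greedy ex gr 1%N; rewrite !expr1 in c0 *.
rewrite trace_scale//; last by case: (pA1 x).
have t0 : (0 < trace (rank_one x))%E.
  apply: rank_one_trace_gt0; apply/eqP => x0.
  by have := oner_neq0 R[i]; rewrite -x1 x0 dot0l eqxx.
have fin : trace (rank_one x) \is a fin_num.
  by rewrite ge0_fin_numE ?ltW// rank_one_trace_lty.
by move: t0; rewrite -(fineK fin) lte_fin -!EFinM lee_fin => t0; rewrite ler_pM2r.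
Qed.
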